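(* Let $X$ be a complex Banach space of holomorphic functions on the open unit disc $\mathbb{D}$ that embeds continuously in $\mathrm{Hol}(\mathbb{D})$. Let $\phi:\mathbb{D}\to\mathbb{D}$ be holomorphic, not an elliptic automorphism, such that the composition operator $C_\phi$ is a bounded operator on $X$, and suppose that the Denjoy--Wolff point $\alpha$ of $\phi$ satisfies $|\alpha|=1$. Suppose that $\mathbb{C}[z]\subset X$ and that each $L\in X'$ satisfying $L(e_n)=L(e_1)^n$ for all $n\ge 0$ has the form $L(f)=\delta_{z_0}(f):=f(z_0)$ $(f\in X)$ for some $z_0\in\mathbb{D}$. Then $\sup_n\|C_\phi^n\|=\infty$. Therefore weak convergence of $(C_\phi^n)_{n\ge1}$ cannot occur, i.e. there is no bounded operator $P$ on $X$ such that $C_\phi^n f\to Pf$ weakly for all $f\in X$.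
   Context: $\mathrm{Hol}(\mathbb{D})$ is the Fréchet space of holomorphic functions on $\mathbb{D}$; $X$ embeds continuously in it means that for every $\lambda\in\mathbb{D}$ the point evaluation $\delta_\lambda:f\mapsto f(\lambda)$ is bounded from $X$ to $\mathbb{C}$. $X'$ is the dual space of $X$. $e_n(z)=z^n$ for $n\ge0$, and $\mathbb{C}[z]$ denotes the polynomials. The composition operator is $C_\phi f=f\circ\phi$. An elliptic automorphism is a map $\psi_a\circ R_\theta\circ\psi_a$ with $a\in\mathbb{D}$, $\psi_a(z)=\frac{a-z}{1-\overline{a}z}$, $R_\theta(z)=e^{i\theta}z$, $\theta\in\mathbb{R}$ (this includes the identity). If $\phi$ is not an elliptic automorphism, its Denjoy--Wolff point is the unique $\alpha\in\overline{\mathbb{D}}$ such that the iterates $\phi^{(n)}=\phi\circ\cdots\circ\phi$ ($n$ factors) converge to $\alpha$ uniformly on compact subsets of $\mathbb{D}$. *)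

(* Defs.v *)
From HB Require Import structures.
From mathcomp Require Import all_boot all_order all_algebra.
From mathcomp Require Import all_classical all_reals all_analysis.
From mathcomp Require Import complex.

Set Implicit Arguments.
Unset Strict Implicit.
Unset Printing Implicit Defensive.

Import Order.TTheory GRing.Theory Num.Theory.
Import numFieldNormedType.Exports.

Local Open Scope classical_set_scope.
Local Open Scope ring_scope.
Local Open Scope complex_scope.

(* [complex R] itself carries no topology: the topological, normed and
   differential structures live on the regular algebra over it.  The norm of a
   vector is a (nonnegative real) element of [R[i]]. *)
Notation Cplx R := ((complex R)^o).

Definition disc (R : realType) : set (Cplx R) := [set z | `|z| < 1].
Arguments disc : clear implicits.

(* Functions on the disc are represented by total functions on the plane whose
   values outside the disc are irrelevant.  As [h] ranges over the complex
   numbers in the limit defining [derivable], differentiability in the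
   direction 1 is complex differentiability. *)
Definition holomorphic_on_disc (R : realType) (f : Cplx R -> Cplx R) : Prop :=
  forall z, disc R z -> derivable f z 1.

Definition hol_self_map (R : realType) (phi : Cplx R -> Cplx R) : Prop :=
  holomorphic_on_disc phi /\ forall z, disc R z -> disc R (phi z).

Definition expi (R : realType) (theta : R) : Cplx R := cos theta +i* sin theta.

Definition rotation (R : realType) (theta : R) (z : Cplx R) : Cplx R :=
  expi theta * z.

Definition psi (R : realType) (a z : Cplx R) : Cplx R :=
  (a - z) / (1 - a^*%C * z).

Definition elliptic_automorphism (R : realType) (phi : Cplx R -> Cplx R) :
    Prop :=
  exists (a : Cplx R) (theta : R), disc R a /\
    forall z, disc R z -> phi z = psi a (rotation theta (psi a z)).

Definition denjoy_wolff_point (R : realType) (phi : Cplx R -> Cplx R)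
    (alpha : Cplx R) : Prop :=
  `|alpha| <= 1 /\
  forall K : set (Cplx R), compact K -> K `<=` disc R ->
    {uniform K, (fun n => iter n phi) @ \oo --> cst alpha}.

Definition bounded_operator (R : realType) (V W : normedModType R[i])
    (T : V -> W) : Prop :=
  linear T /\ exists M : R, forall x, `|T x| <= M%:C * `|x|.

Definition opnorm (R : realType) (V W : normedModType R[i]) (T : V -> W) :
    \bar R :=
  ereal_sup [set (complex.Re `|T x|)%:E | x in [set x | `|x| <= 1]].

Definition weak_cvg (R : realType) (V : normedModType R[i]) (u : nat -> V)
    (x : V) : Prop :=
  forall L : V -> Cplx R, bounded_operator L -> L (u n) @[n --> \oo] --> L x.

(* [ev f] is the function on the disc that [f : X] is: [ev] identifies the
   vector space [X] with a linear subspace of the holomorphic functions. *)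
Definition hol_function_space (R : realType) (X : normedModType R[i])
    (ev : X -> Cplx R -> Cplx R) : Prop :=
  [/\ forall (a : R[i]) (f g : X) z, disc R z ->
        ev (a *: f + g) z = a * ev f z + ev g z,
      forall f g : X, (forall z, disc R z -> ev f z = ev g z) -> f = g
    & forall f : X, holomorphic_on_disc (ev f)].

Definition embeds_continuously_in_Hol (R : realType) (X : normedModType R[i])
    (ev : X -> Cplx R -> Cplx R) : Prop :=
  forall z, disc R z -> bounded_operator (fun f : X => ev f z).

Definition represents (R : realType) (X : normedModType R[i])
    (ev : X -> Cplx R -> Cplx R) (f : X) (g : Cplx R -> Cplx R) : Prop :=
  forall z, disc R z -> ev f z = g z.

Definition composition_operator (R : realType) (X : normedModType R[i])
    (ev : X -> Cplx R -> Cplx R) (phi : Cplx R -> Cplx R) (T : X -> X) : Prop :=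
  forall f, represents ev (T f) (ev f \o phi).

(* Main.v *)
(* If the operators [C_phi^n] were uniformly bounded, so would be the functionals
   [f |-> f(phi^n(0))]; let [L] be a weak-* limit of these along an ultrafilter.
   As [phi^n(0)] tends to [alpha], [L(e_k) = alpha^k = L(e_1)^k], so [L] is the
   evaluation at a point [z0] of the disc, and [z0 = L(e_1) = alpha] has modulus
   1, which is absurd.  If [C_phi^n f -> P f] weakly, then [f |-> (P f)(0)] can
   be used for [L] directly, without the uniform boundedness principle. *)
Require Import Defs.
From HB Require Import structures.
From mathcomp Require Import all_boot all_order all_algebra.
From mathcomp Require Import all_classical all_reals all_analysis.
From mathcomp Require Import complex.
Import Order.TTheory GRing.Theory Num.Theory.
Import numFieldNormedType.Exports.
Local Open Scope classical_set_scope.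
Local Open Scope ring_scope.
Local Open Scope complex_scope.

Lemma normc_ge_Im (R : rcfType) (z : R[i]) : `|complex.Im z|%:C <= `|z|.
Proof. by rewrite normc_def lecR -sqrtr_sqr ler_wsqrtr// lerDr sqr_ge0. Qed.

(** In the order of [R[i]], being nonnegative includes having zero imaginary part; this lets norms
    be traded for real bounds. *)
Lemma norm_real_complex (R : realType) (V : normedModType R[i]) (x : V) :
  `|x| = (complex.Re `|x|)%:C.
Proof.
by have := normr_ge0 x; rewrite lecE; case: `|x| => a b /andP[/eqP /= ->].
Qed.

(** Compactness of [[-M, M]] yields a cluster point [l]. An ultrafilter contains the preimage of a
    neighbourhood of [l] or that of its complement, and clustering rules out the latter. *)
Lemma ultra_bounded_cvg (R : realType) (T : Type) (F : set_system T)
    (u : T -> R) (M : R) {FU : UltraFilter F} :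
  (\forall x \near F, `|u x| <= M) -> exists l : R, u x @[x --> F] --> l.
Proof.
move=> uM.
have [|l [_ cl_l]] := @segment_compact R (- M) M (u @ F) _.
  by apply: filterS uM => x /=; rewrite in_itv /= -ler_norml.
exists l => A Al.
have [//|FA] := @in_ultra_setVsetC _ F (u @^-1` A) FU.
by have [y [nAy Ay]] := cl_l (~` A) A FA Al.
Qed.

Lemma ultra_bounded_cvgc (R : realType) (T : Type) (F : set_system T)
    (u : T -> Cplx R) (M : R) {FU : UltraFilter F} :
  (\forall x \near F, `|u x| <= M%:C) -> exists l : Cplx R, u x @[x --> F] --> l.
Proof.
move=> uM.
have [|a ua] := ultra_bounded_cvg _ _ _ (fun x => complex.Re (u x)) M _.
  by apply: filterS uM => x uxM; rewrite -lecR (le_trans (normc_ge_Re _)).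
have [|b ub] := ultra_bounded_cvg _ _ _ (fun x => complex.Im (u x)) M _.
  by apply: filterS uM => x uxM; rewrite -lecR (le_trans (normc_ge_Im _ _)).
exists (a +i* b); apply/cvgrPdist_lt => -[e e'].
(* A positive element of [R[i]] is real, so the real and imaginary parts can each be kept within
   half of it. *)
rewrite ltcE /= => /andP[/eqP -> e0].
have e20 : 0 < e / 2 by rewrite divr_gt0.
move/cvgrPdist_lt/(_ _ e20) : ua => ua.
move/cvgrPdist_lt/(_ _ e20) : ub => ub.
apply: filterS2 ua ub => x ax bx.
have -> : (a +i* b : Cplx R) - u x =
   (a - complex.Re (u x))%:C + 'i%C * (b - complex.Im (u x))%:C.
  by rewrite [LHS]complexE /=; case: (u x).
apply: le_lt_trans (ler_normD _ _) _.
have ni : `|'i%C : R[i]| = 1.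
  by rewrite normc_def /= expr0n expr1n add0r sqrtr1.
rewrite normrM ni mul1r !normc_def /= expr0n /= !addr0 !sqrtr_sqr.
rewrite -(rmorphD (real_complex R)) ltcR.
by rewrite (splitr e) ltrD.
Qed.

Lemma cvg_norm_le (K : numFieldType) (V : normedModType K) (T : Type)
    (F : set_system T) (u : T -> V) (l : V) (M : K) : ProperFilter F ->
  u x @[x --> F] --> l -> (\forall x \near F, `|u x| <= M) -> `|l| <= M.
Proof.
move=> FF ul uM; apply/ler_addgt0Pl => e e0.
move/cvgrPdist_lt/(_ _ e0) : ul => ul.
have [x [uxM ulx]] := filter_ex (filterI uM ul).
rewrite -(subrK (u x) l); apply: le_trans (ler_normD _ _) _.
by rewrite lerD// ltW.
Qed.

(* Banach-Alaoglu; an ultrafilter replaces the subsequence, so that [X] need not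
   be separable. *)
Lemma bounded_functionals_cluster (R : realType) (X : normedModType R[i])
    (l : nat -> X -> Cplx R) (M : R) : (forall n, linear (l n)) ->
  (\forall n \near \oo, forall x, `|l n x| <= M%:C * `|x|) ->
  exists (U : set_system nat) (L : X -> Cplx R),
    [/\ ProperFilter U, \oo `<=` U, bounded_operator L
      & forall x, l n x @[n --> U] --> L x].
Proof.
move=> llin lM; have [U [UU ooU]] := ultraFilterLemma (@eventually_filter).
have UM x : \forall n \near U, `|l n x| <= M%:C * `|x|.
  by apply: ooU; apply: filterS lM => n; apply.
have /choice[L lL] : forall x, exists y : Cplx R, l n x @[n --> U] --> y.
  move=> x; apply: (ultra_bounded_cvgc _ _ _ _ (M * complex.Re `|x|)).
  by rewrite rmorphM/= -norm_real_complex; exact: UM.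
exists U, L; split=> //; first exact: ultra_proper.
split.
  (* Linearity passes to [L] because limits along [U] are unique. *)
  move=> a x y; apply: (norm_cvg_unique (lL _)).
  have -> : (fun n => l n (a *: x + y)) = (fun n => a *: l n x + l n y).
    by apply/funext => n; exact: llin.
  by apply: cvgD => //; apply: cvgZl_tmp.
by exists M => x; apply: cvg_norm_le _ (lL x) (UM x).
Qed.

(** A bound [M] may be negative when [V] is trivial; chaining two bounds by multiplication needs a
    nonnegative one. *)
Lemma bounded_operator_ge0 (R : realType) (V W : normedModType R[i])
    (T : V -> W) : bounded_operator T ->
  exists2 M : R, 0 <= M & forall x, `|T x| <= M%:C * `|x|.
Proof.
move=> [_ [M TM]]; exists (Num.max 0 M); first by rewrite le_max lexx.
move=> x; apply: le_trans (TM x) _.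
by rewrite ler_wpM2r// lecR le_max lexx orbT.
Qed.

Lemma bounded_operator_comp (R : realType) (U V W : normedModType R[i])
    (S : V -> W) (T : U -> V) :
  bounded_operator S -> bounded_operator T -> bounded_operator (S \o T).
Proof.
move=> bS [Tlin [M TM]]; have [N N0 SN] := bounded_operator_ge0 _ _ _ _ bS.
split; first by move=> a x y; rewrite /= Tlin bS.1.
exists (N * M) => x /=; apply: le_trans (SN _) _.
by rewrite rmorphM/= -mulrA ler_wpM2l// lecR.
Qed.

(** For [x != 0], homogeneity reduces the claim to the unit vector [|x|^-1 *: x], which is among
    those over which the supremum is taken. *)
Lemma opnorm_ub (R : realType) (V W : normedModType R[i]) (T : V -> W) (M : R) :
  linear T -> (opnorm T <= M%:E)%E -> forall x, `|T x| <= M%:C * `|x|.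
Proof.
move=> Tlin TM x.
have T0 : T 0 = 0 by have := Tlin (-1) 0 0; rewrite scaler0 addr0 scaleN1r addNr.
have [->|x0] := eqVneq x 0; first by rewrite T0 !normr0 mulr0.
have nx0 : `|x| != 0 by rewrite normr_eq0.
have TZ a y : T (a *: y) = a *: T y by have := Tlin a y 0; rewrite T0 !addr0.
rewrite -ler_pdivrMr ?normr_gt0// mulrC -[`|x|^-1]ger0_norm ?invr_ge0//.
rewrite -normrZ -TZ [`|T _|]norm_real_complex lecR -lee_fin; apply: le_trans TM.
apply: ereal_sup_ubound => /=; exists (`|x|^-1 *: x) => //=.
by rewrite normrZ ger0_norm ?invr_ge0// mulVf.
Qed.

Lemma linear_iter (K : pzRingType) (V : lmodType K) (T : V -> V) n :
  linear T -> linear (iter n T).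
Proof. by move=> Tlin; elim: n => [|n IHn] a x y //=; rewrite IHn Tlin. Qed.

Lemma cvg_expn (K : numFieldType) (T : Type) (F : set_system T)
    (u : T -> K^o) (a : K^o) k : Filter F ->
  u x @[x --> F] --> a -> (u x ^+ k : K^o) @[x --> F] --> (a ^+ k : K^o).
Proof.
move=> FF ua; elim: k => [|k IHk]; first exact: cvg_cst.
have -> : (fun x => u x ^+ k.+1) = (fun x => u x * u x ^+ k).
  by apply/funext => x; rewrite exprS.
by rewrite exprS; exact: cvgM.
Qed.

Lemma disc0 (R : realType) : disc R 0. Proof. by rewrite /disc /= normr0. Qed.

Lemma iter_disc (R : realType) (phi : Cplx R -> Cplx R) z n :
  hol_self_map phi -> disc R z -> disc R (iter n phi z).
Proof. by move=> [_ phiD] Dz; elim: n => //= n; exact: phiD. Qed.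

Lemma denjoy_wolff_cvg (R : realType) (phi : Cplx R -> Cplx R)
    (alpha z : Cplx R) :
  denjoy_wolff_point phi alpha -> disc R z ->
  iter n phi z @[n --> \oo] --> alpha.
Proof.
move=> [_ dw] Dz.
(* On the compact set [[set z]], uniform convergence is convergence at [z]. *)
have := dw [set z] (@compact_set1 _ z).
by rewrite uniform_set1; apply => _ ->.
Qed.

Lemma ev_iter (R : realType) (X : normedModType R[i])
    (ev : X -> Cplx R -> Cplx R) (phi : Cplx R -> Cplx R) (Cphi : X -> X)
    (f : X) (z : Cplx R) n :
  hol_self_map phi -> composition_operator ev phi Cphi -> disc R z ->
  ev (iter n Cphi f) z = ev f (iter n phi z).
Proof.
(* The point [z] is generalized: peeling off the outer [Cphi] moves the evaluation to [phi z]. *)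
move=> Hphi HC; elim: n z => // n IHn z Dz.
by rewrite [LHS]HC// iterSr /= IHn//; exact: Hphi.2.
Qed.

Theorem theorem4p3 (R : realType)
  (X : completeNormedModType R[i]) (ev : X -> Cplx R -> Cplx R)
  (HX : hol_function_space ev) (Hemb : embeds_continuously_in_Hol ev)
  (phi : Cplx R -> Cplx R) (Hphi : hol_self_map phi)
  (Hell : ~ elliptic_automorphism phi)
  (Cphi : X -> X) (HC : composition_operator ev phi Cphi)
  (HCb : bounded_operator Cphi)
  (alpha : Cplx R) (Halpha : denjoy_wolff_point phi alpha)
  (Halpha1 : `|alpha| = 1)
  (Hpoly : forall p : {poly R[i]},
     exists f : X, represents ev f (fun z => p.[z]))
  (e : nat -> X) (He : forall n, represents ev (e n) (fun z => z ^+ n))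
  (Hchar : forall L : X -> Cplx R, bounded_operator L ->
     (forall n, L (e n) = L (e 1%N) ^+ n) ->
     exists2 z0, disc R z0 & forall f, L f = ev f z0) :
  ereal_sup [set opnorm (iter n Cphi) | n in [set n : nat | (1 <= n)%N]] = +oo%E
  /\
  ~ (exists P : X -> X, bounded_operator P /\
       forall f, weak_cvg (fun n => iter n Cphi f) (P f)).
Proof.
have D0 := disc0 R; have bev0 := Hemb 0 D0.
(* Common core of both claims: [U] will be [\oo] for weak convergence and the filter obtained by
   weak-* compactness for the norm bound. *)
have no_limit (U : set_system nat) (L : X -> Cplx R) : ProperFilter U ->
    \oo `<=` U -> bounded_operator L ->
    ~ (forall f, ev (iter n Cphi f) 0 @[n --> U] --> L f).
  move=> UU ooU bL evL.
  have Le k : L (e k) = alpha ^+ k.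
    apply: (norm_cvg_unique (evL _)).
    have -> : (fun n => ev (iter n Cphi (e k)) 0) = (fun n => iter n phi 0 ^+ k).
      apply/funext => n; rewrite (ev_iter _ _ _ phi)// He//; exact: iter_disc.
    apply: cvg_expn; apply: cvg_trans (denjoy_wolff_cvg _ _ _ _ Halpha D0).
    exact: cvg_app.
  have [|z Dz Lz] := Hchar L bL; first by move=> n; rewrite !Le expr1.
  have : `|z| < 1 := Dz.
  (* Testing on [e 1] gives [z = alpha], of modulus 1. *)
  by rewrite -[z]expr1 -He// -Lz Le expr1 Halpha1 ltxx.
split; last first.
  move=> [P [bP CP]].
  (* The limit functional is [f |-> (P f)(0)]; weak convergence is tested against evaluation at
     0. *)
  have bL := bounded_operator_comp _ _ _ _ _ _ bev0 bP.
  apply: (no_limit \oo _ _ (fun=> id) bL) => f; exact: CP f _ bev0.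
have [M0 M0ge0 ev0M] := bounded_operator_ge0 _ _ _ _ bev0.
apply/eqP; rewrite -leye_eq leNgt; apply/negP => supCy.
set s := ereal_sup _ in supCy.
have Cs n : (1 <= n)%N -> (opnorm (iter n Cphi) <= s)%E.
  by move=> n1; apply: ereal_sup_ubound; exists n.
have iterlin n : linear (iter n Cphi) := linear_iter _ _ _ n HCb.1.
(* As an extended real below [+oo], [s] is either real or [-oo]; in the latter case 0 serves as a
   bound. *)
have [M sM] : exists M : R, (s <= M%:E)%E.
  by case: (s) supCy => [r _||_] //; [exists r | exists 0; rewrite leNye].
have [||U [L [UU ooU bL evL]]] :=
    bounded_functionals_cluster R X (fun n f => ev (iter n Cphi f) 0) (M0 * M).
- by move=> n a f g; rewrite iterlin; exact: bev0.1.
(* The supremum controls only [n >= 1], which suffices for a bound near [\oo]. *)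
- exists 1%N => // n n1 f; apply: le_trans (ev0M _) _.
  rewrite rmorphM/= -mulrA ler_wpM2l// ?lecR//.
  by apply: opnorm_ub => //; exact: le_trans (Cs n n1) sM.
exact: (no_limit U L).
Qed.
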